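(* Let $\alpha_1$ be the sequence consisting of two $4$'s followed by fourteen $11$'s, and let $\alpha_2$ be the sequence consisting of twenty-two $4$'s followed by two $11$'s. Then $\alpha_1$ and $\alpha_2$ are distinct middle elements of triples of $\mathcal{G}_\oplus\big((4,4),(11,11)\big)$, and $$\breve K(\alpha_1)=\breve K(\alpha_2)=661068612553111 .$$ Therefore the number $661068612553111$ appears at least twice (at two different vertices) as a maximal (middle) element in the generalised Markov triples of $T_{(4,4),(11,11)}$.
   Context: Concatenation of finite sequences is denoted $\oplus$. For finite sequences $\mu,\nu$, $\mathcal{G}_\oplus(\mu,\nu)$ is the directed graph whose vertices are the triples obtained from $(\mu,\mu\oplus\nu,\nu)$ by compositions of $L(\alpha,\beta,\gamma)=(\alpha,\alpha\oplus\beta,\beta)$ and $R(\alpha,\beta,\gamma)=(\beta,\beta\oplus\gamma,\gamma)$, with an edge from each vertex $v$ to $L(v)$ and to $R(v)$. Continuants: $K_0()=1$, $K_1(x_1)=x_1$, $K_n(x_1,\ldots,x_n)=x_nK_{n-1}(x_1,\ldots,x_{n-1})+K_{n-2}(x_1,\ldots,x_{n-2})$; for $\alpha=(a_1,\ldots,a_n)$ put $\breve K(\alpha)=K_{n-1}(a_1,\ldots,a_{n-1})$. The graph $T_{\mu,\nu}$ of generalised Markov triples is obtained from $\mathcal{G}_\oplus(\mu,\nu)$ by replacing each triple of sequences $(\alpha,\beta,\gamma)$ by the triple of integers $(\breve K(\alpha),\breve K(\beta),\breve K(\gamma))$. (The generalised uniqueness conjecture asserts that every generalised Markov number appears exactly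 once as a maximal (middle) element of a triple in $T_{\mu,\nu}$.) *)

(* Defs.v *)
From Stdlib Require Import ZArith List.
Import ListNotations.
Open Scope Z_scope.

Record digraph (V : Type) := Digraph {
  vertex : V -> Prop;
  edge : V -> V -> Prop
}.
Arguments vertex {V} _ _.
Arguments edge {V} _ _ _.

Definition triple (A : Type) : Type := (A * A * A)%type.

Definition left_elt {A : Type} (t : triple A) : A := fst (fst t).
Definition middle {A : Type} (t : triple A) : A := snd (fst t).
Definition right_elt {A : Type} (t : triple A) : A := snd t.

Definition Lmap (t : triple (list Z)) : triple (list Z) :=
  let '(a, b, c) := t in (a, a ++ b, b).

Definition Rmap (t : triple (list Z)) : triple (list Z) :=
  let '(a, b, c) := t in (b, b ++ c, c).

Inductive Gvertex (mu nu : list Z) : triple (list Z) -> Prop :=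
| Gvertex_root : Gvertex mu nu (mu, mu ++ nu, nu)
| Gvertex_L (v : triple (list Z)) : Gvertex mu nu v -> Gvertex mu nu (Lmap v)
| Gvertex_R (v : triple (list Z)) : Gvertex mu nu v -> Gvertex mu nu (Rmap v).

Definition Gplus (mu nu : list Z) : digraph (triple (list Z)) := {|
  vertex := Gvertex mu nu;
  edge := fun u v => Gvertex mu nu u /\ (v = Lmap u \/ v = Rmap u)
|}.

(* The recurrence for K peels entries off the end of the sequence, so it is
   run on the reversed list; [K_app2] below is the recurrence for K itself. *)
Fixpoint Krev (l : list Z) : Z :=
  match l with
  | [] => 1
  | x :: l' =>
      match l' with
      | [] => x
      | _ :: l'' => x * Krev l' + Krev l''
      end
  end.

Definition K (l : list Z) : Z := Krev (rev l).

Lemma K_nil : K [] = 1.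
Proof. reflexivity. Qed.

Lemma K_one (x : Z) : K [x] = x.
Proof. reflexivity. Qed.

Lemma K_app2 (l : list Z) (y x : Z) :
  K ((l ++ [y]) ++ [x]) = x * K (l ++ [y]) + K l.
Proof. unfold K; rewrite !rev_app_distr; reflexivity. Qed.

(* Only meaningful on nonempty sequences: the value 1 at [] is a junk value. *)
Definition Kbreve (l : list Z) : Z := K (removelast l).

Definition Kbreve3 (t : triple (list Z)) : triple Z :=
  let '(a, b, c) := t in (Kbreve a, Kbreve b, Kbreve c).

(* Image of a graph under a relabelling of its vertices; vertices that receive
   equal labels are identified, so distinct vertices of the image come from
   distinct vertices of the original graph. *)
Definition map_digraph {V W : Type} (f : V -> W) (G : digraph V) : digraph W := {|
  vertex := fun w => exists v, vertex G v /\ f v = w;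
  edge := fun w w' => exists v v', edge G v v' /\ f v = w /\ f v' = w'
|}.

Definition Tgraph (mu nu : list Z) : digraph (triple Z) :=
  map_digraph Kbreve3 (Gplus mu nu).

Definition is_middle_of {A : Type} (G : digraph (triple A)) (a : A) : Prop :=
  exists v, vertex G v /\ middle v = a.

Definition max_middle (t : triple Z) (n : Z) : Prop :=
  middle t = n /\ left_elt t <= n /\ right_elt t <= n.

(* Main.v *)
Require Import Defs.
From Stdlib Require Import ZArith List.
Import ListNotations.
Open Scope Z_scope.

(** Both sequences lie on the boundary branches of the graph: iterating [Rmap] from the root keeps
    appending [nu] to the middle, iterating [Lmap] keeps prepending [mu]. The coincidence of the two
    continuants is then a computation, made feasible by [K_fold]. The outer entries of the two
    integer triples differ, so the repetition occurs at distinct vertices of [Tgraph] too. *)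

Definition continuant_step (p : Z * Z) (x : Z) : Z * Z :=
  (x * fst p + snd p, fst p).

(** The state is a pair of consecutive continuants; the seed [(1, 0)] uses the convention that the
    continuant of index -1 is 0. *)
Lemma Krev_fold (l : list Z) :
  Krev l = fst (fold_right (fun x p => continuant_step p x) (1, 0) l).
Proof.
  (* The recurrence looks two terms back, so the induction carries two consecutive values. *)
  enough (H : forall x,
    Krev l = fst (fold_right (fun y p => continuant_step p y) (1, 0) l) /\
    Krev (x :: l) =
      fst (fold_right (fun y p => continuant_step p y) (1, 0) (x :: l)))
    by apply (H 0).
  induction l as [|y l IH]; intro x.
  - simpl; split; ring.
  - destruct (IH y) as [E1 E2]; split; [exact E2|].
    change (Krev (x :: y :: l)) with (x * Krev (y :: l) + Krev l).
    rewrite E1, E2; reflexivity.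
Qed.

(* [Krev] recurses twice and so evaluates in exponential time; the fold carries
   the last two continuants along and is linear. *)
Lemma K_fold (l : list Z) : K l = fst (fold_left continuant_step l (1, 0)).
Proof.
  unfold K; rewrite Krev_fold.
  now rewrite (fold_left_rev_right (fun x p => continuant_step p x)).
Qed.

Lemma Gvertex_iter_L (mu nu : list Z) (n : nat) :
  Gvertex mu nu (Nat.iter n Lmap (mu, mu ++ nu, nu)).
Proof. induction n; simpl; now constructor. Qed.

Lemma Gvertex_iter_R (mu nu : list Z) (n : nat) :
  Gvertex mu nu (Nat.iter n Rmap (mu, mu ++ nu, nu)).
Proof. induction n; simpl; now constructor. Qed.

Theorem mainTheorem4 :
  let mu := [4; 4] in
  let nu := [11; 11] in
  let alpha1 := repeat 4 2 ++ repeat 11 14 in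
  let alpha2 := repeat 4 22 ++ repeat 11 2 in
  let N := 661068612553111 in
  alpha1 <> alpha2 /\
  is_middle_of (Gplus mu nu) alpha1 /\
  is_middle_of (Gplus mu nu) alpha2 /\
  Kbreve alpha1 = N /\
  Kbreve alpha2 = N /\
  exists v1 v2 : triple (list Z),
    vertex (Gplus mu nu) v1 /\ vertex (Gplus mu nu) v2 /\
    middle v1 = alpha1 /\ middle v2 = alpha2 /\
    v1 <> v2 /\
    vertex (Tgraph mu nu) (Kbreve3 v1) /\ vertex (Tgraph mu nu) (Kbreve3 v2) /\
    Kbreve3 v1 <> Kbreve3 v2 /\
    max_middle (Kbreve3 v1) N /\ max_middle (Kbreve3 v2) N.
Proof.
  intros mu nu alpha1 alpha2 N.
  set (root := (mu, mu ++ nu, nu)).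
  (* The root already holds one [mu] and one [nu], so the exponents are 14/2 - 1 = 6 and 22/2 - 1 =
     10. *)
  set (v1 := Nat.iter 6 Rmap root).
  set (v2 := Nat.iter 10 Lmap root).
  assert (V1 : vertex (Gplus mu nu) v1) by apply Gvertex_iter_R.
  assert (V2 : vertex (Gplus mu nu) v2) by apply Gvertex_iter_L.
  assert (M1 : middle v1 = alpha1) by reflexivity.
  assert (M2 : middle v2 = alpha2) by reflexivity.
  split; [discriminate|].
  split; [now exists v1|].
  split; [now exists v2|].
  assert (E1 : Kbreve alpha1 = N)
    by (unfold Kbreve; rewrite K_fold; vm_compute; reflexivity).
  assert (E2 : Kbreve alpha2 = N)
    by (unfold Kbreve; rewrite K_fold; vm_compute; reflexivity).
  split; [exact E1|].
  split; [exact E2|].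
  (* The explicit outer entries serve both to separate the two triples and to show that [N] is
     maximal in each. *)
  assert (T1 : Kbreve3 v1 = (5374896860084, N, 11)).
  { change v1 with (mu ++ repeat 11 12, alpha1, nu); unfold Kbreve3.
    rewrite E1; unfold Kbreve; rewrite !K_fold; vm_compute; reflexivity. }
  assert (T2 : Kbreve3 v2 = (4, N, 36840091137091)).
  { change v2 with (mu, alpha2, repeat 4 20 ++ nu); unfold Kbreve3.
    rewrite E2; unfold Kbreve; rewrite !K_fold; vm_compute; reflexivity. }
  exists v1, v2.
  split; [exact V1|].
  split; [exact V2|].
  split; [exact M1|].
  split; [exact M2|].
  split; [discriminate|].
  split; [exact (ex_intro _ v1 (conj V1 eq_refl))|].
  split; [exact (ex_intro _ v2 (conj V2 eq_refl))|].
  rewrite T1, T2.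
  split; [discriminate|].
  (* [<=] on [Z] says that the comparison is not [Gt], so on numerals [discriminate] decides it. *)
  split; (split; [reflexivity|]; split; discriminate).
Qed.
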